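(* Let $C \subset \mathbb{H}^d$. Consider the conditions: (a) $C$ is a body of constant width $\delta$; (b) $C$ is a body of constant diameter $\delta$; (c) $C$ is a complete body of diameter $\delta$. Then (a) implies (b), and (b) is equivalent to (c).
   Context: $\mathbb{H}^d$ is the $d$-dimensional hyperbolic space, and $|ab|$ is the hyperbolic distance of points $a,b$. A set is convex if with every two points it contains the geodesic segment joining them. A convex body in $\mathbb{H}^d$ is a closed bounded convex set with non-empty interior; $\mathrm{bd}$ denotes boundary. A hyperplane $H$ supports a convex body $C$ if $H$ has a common point with $C$ and $H$ is disjoint from the interior of $C$. For non-empty sets $A,B$, $\mathrm{dist}(A,B)$ is the infimum of $|ab|$ over $a\in A$, $b\in B$. Two hyperplanes are ultraparallel if they do not intersect in a real or imaginary point (that is, they meet neither in $\mathbb{H}^d$ nor at infinity). For a hyperplane $H$ supporting a convex body $C$, the width $\mathrm{width}_H(C)$ of $C$ determined by $H$ is the distance $\mathrm{dist}(H,J)$ between $H$ and any farthest (from $H$) hyperplane $J$ among those ultraparallel to $H$ and supporting $C$. The diameter $\mathrm{diam}(A)$ of a set $A$ is the supremum of the distances between pairs of points of $A$. A convex body $W$ is a body of constant width $\delta$ if $\mathrm{width}_H(W)=\delta$ for every hyperplane $H$ supporting $W$. A convex body $D$ is of constant diameter $\delta$ if $\mathrm{diam}(D)=\delta$ and for every $p\in\mathrm{bd}(D)$ there is a point $p'\in\mathrm{bd}(D)$ with $|pp'|=\delta$. A set $C\subset\mathbb{H}^d$ of diameter $\delta$ is complete if $\mathrm{diam}(C\cup\{x\})>\delta$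 for every $x\notin C$; a complete body is a convex body which is a complete set. *)

(* Defs.v *)
From HB Require Import structures.
From mathcomp Require Import all_boot all_order all_algebra.
From mathcomp Require Import ring lra.
From mathcomp Require Import all_classical all_reals all_analysis.

Set Implicit Arguments.
Unset Strict Implicit.
Unset Printing Implicit Defensive.

Import Order.TTheory GRing.Theory Num.Theory.
Import numFieldTopology.Exports.

Local Open Scope classical_set_scope.
Local Open Scope ring_scope.

Section LorentzForm.
Context {R : realType} {d : nat}.
Implicit Types (u v w : 'rV[R]_d.+1) (a : R).

Definition time u : R := u 0 ord0.

Definition sdot u v : R :=
  \sum_(i < d) u 0 (lift ord0 i) * v 0 (lift ord0 i).

Definition lorentz u v : R := - (time u * time v) + sdot u v.

Lemma sdotC u v : sdot u v = sdot v u.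
Proof. by apply: eq_bigr => i _; rewrite mulrC. Qed.

Lemma sdotDl u v w : sdot (u + v) w = sdot u w + sdot v w.
Proof. by rewrite -big_split; apply: eq_bigr => i _; rewrite mxE mulrDl. Qed.

Lemma sdotZl a u w : sdot (a *: u) w = a * sdot u w.
Proof. by rewrite big_distrr; apply: eq_bigr => i _; rewrite mxE /= mulrA. Qed.

Lemma sdot_ge0 u : 0 <= sdot u u.
Proof. by apply: sumr_ge0 => i _; rewrite -expr2 sqr_ge0. Qed.

Lemma lorentzC u v : lorentz u v = lorentz v u.
Proof. by rewrite /lorentz sdotC [time u * _]mulrC. Qed.

Lemma lorentzDl u v w : lorentz (u + v) w = lorentz u w + lorentz v w.
Proof. by rewrite /lorentz sdotDl /time mxE; ring. Qed.

Lemma lorentzZl a u w : lorentz (a *: u) w = a * lorentz u w.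
Proof. by rewrite /lorentz sdotZl /time mxE; ring. Qed.

Lemma lorentzDr u v w : lorentz w (u + v) = lorentz w u + lorentz w v.
Proof. by rewrite !(lorentzC w) lorentzDl. Qed.

Lemma lorentzZr a u w : lorentz w (a *: u) = a * lorentz w u.
Proof. by rewrite !(lorentzC w) lorentzZl. Qed.

Lemma discr_le (A B C : R) :
  (forall s t, 0 <= s ^+ 2 * A + 2 * s * t * B + t ^+ 2 * C) ->
  B ^+ 2 <= A * C.
Proof.
move=> H.
have A0 : 0 <= A by have := H 1 0; lra.
have C0 : 0 <= C by have := H 0 1; lra.
have [C1|C1] := eqVneq C 0.
  suff -> : B = 0 by rewrite C1; lra.
  apply/eqP; apply: contraT => B0.
  have := H 1 (- (A + 1) / (2 * B)).
  have -> : 1 ^+ 2 * A + 2 * 1 * (- (A + 1) / (2 * B)) * B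
     + (- (A + 1) / (2 * B)) ^+ 2 * C = -1 by rewrite C1; field.
  by rewrite ler0N1.
have Cp : 0 < C by rewrite lt_def C1.
have := H C (- B).
have -> : C ^+ 2 * A + 2 * C * - B * B + (- B) ^+ 2 * C = C * (A * C - B ^+ 2).
  by ring.
by rewrite pmulr_rge0// subr_ge0.
Qed.

Lemma sdot_CS u v : sdot u v ^+ 2 <= sdot u u * sdot v v.
Proof.
apply: discr_le => s t.
have := sdot_ge0 (s *: u + t *: v).
rewrite sdotDl !sdotZl !(sdotC _ (_ + _)) !sdotDl !sdotZl (sdotC v u).
by congr (0 <= _); ring.
Qed.

End LorentzForm.

Section HyperbolicSpace.
Context {R : realType} {d : nat}.

Definition on_hyperboloid (x : 'rV[R]_d.+1) : bool :=
  (lorentz x x == -1) && (0 < time x).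

(* The hyperboloid model: the upper sheet of <x, x> = -1, with distance
   arcosh (- <x, y>). *)
Definition hspace : Type := {x : 'rV[R]_d.+1 | on_hyperboloid x}.
HB.instance Definition _ := SubChoice.on hspace.

Implicit Types x y z : hspace.

Lemma hspaceP x : lorentz (val x) (val x) = -1 /\ 0 < time (val x).
Proof. by have /andP[/eqP] := valP x. Qed.

Lemma lorentz_orth_ge0 x (u : 'rV[R]_d.+1) :
  lorentz u (val x) = 0 -> 0 <= lorentz u u.
Proof.
have [] := hspaceP x; rewrite /lorentz.
set s := time (val x); set t := time u => xx s0 ux.
have := sdot_CS u (val x); have := sdot_ge0 u.
have -> : sdot u (val x) = t * s by lra.
have -> : sdot (val x) (val x) = s * s - 1 by lra.
move: (sdot u u) => a a0 H.
suff : 0 <= s ^+ 2 * (- (t * t) + a) by rewrite pmulr_rge0// exprn_gt0.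
nra.
Qed.

Lemma lorentz_orth_eq0 x (u : 'rV[R]_d.+1) :
  lorentz u (val x) = 0 -> lorentz u u = 0 -> u = 0.
Proof.
have [] := hspaceP x; rewrite /lorentz.
set s := time (val x); set t := time u => xx s0 ux uu.
have := sdot_CS u (val x); have := sdot_ge0 u.
have -> : sdot u (val x) = t * s by lra.
have -> : sdot (val x) (val x) = s * s - 1 by lra.
have -> : sdot u u = t ^+ 2 by lra.
move=> t20 H.
have t2 : t ^+ 2 = 0 by apply/eqP; rewrite eq_le t20 andbT; nra.
have : sdot u u = 0 by lra.
move/eqP; rewrite psumr_eq0; last by move=> i _; rewrite -expr2 sqr_ge0.
move/allP => si0; apply/rowP => j; rewrite mxE.
have [k ->|->] := unliftP ord0 j.
  by have := si0 k (mem_index_enum _); rewrite -expr2 sqrf_eq0 => /eqP.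
by apply/eqP; rewrite -sqrf_eq0 t2.
Qed.

Lemma lorentz_orth_CS x (u v : 'rV[R]_d.+1) :
  lorentz u (val x) = 0 -> lorentz v (val x) = 0 ->
  lorentz u v ^+ 2 <= lorentz u u * lorentz v v.
Proof.
move=> ux vx; apply: discr_le => s t.
have := @lorentz_orth_ge0 x (s *: u + t *: v).
rewrite !(lorentzDl, lorentzDr, lorentzZl, lorentzZr) ux vx (lorentzC v u).
rewrite !mulr0 addr0 => /(_ erefl).
by congr (0 <= _); ring.
Qed.

Definition arcosh (t : R) : R := ln (t + Num.sqrt (t ^+ 2 - 1)).

Definition hdist x y : R := arcosh (- lorentz (val x) (val y)).

Let rej x y : 'rV[R]_d.+1 := val x + lorentz (val x) (val y) *: val y.

Let rej_orth x y : lorentz (rej x y) (val y) = 0.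
Proof. by rewrite lorentzDl lorentzZl (hspaceP y).1; ring. Qed.

Let rejE x y z : lorentz (rej x y) (rej z y) =
  lorentz (val x) (val z) + lorentz (val x) (val y) * lorentz (val z) (val y).
Proof.
rewrite !(lorentzDl, lorentzDr, lorentzZl, lorentzZr) (hspaceP y).1.
by rewrite (lorentzC (val y) (val z)); ring.
Qed.

Lemma lorentz_hspace_le x y : lorentz (val x) (val y) <= -1.
Proof.
have := lorentz_orth_ge0 (rej_orth x y); rewrite rejE (hspaceP x).1 => H.
suff : lorentz (val x) (val y) < 0 by nra.
have [xx x0] := hspaceP x; have [yy y0] := hspaceP y.
have := sdot_CS (val x) (val y).
move: xx yy; rewrite /lorentz.
set s := time _ in x0 *; set t := time _ in y0 *; move=> xx yy.
have -> : sdot (val x) (val x) = s * s - 1 by lra.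
have -> : sdot (val y) (val y) = t * t - 1 by lra.
move: (sdot _ _) => a CS; rewrite addrC subr_lt0.
rewrite ltNge; apply/negP => le.
have st0 : 0 < s * t by rewrite mulr_gt0.
have ss0 : 0 < s * s by rewrite mulr_gt0.
have tt0 : 0 < t * t by rewrite mulr_gt0.
have : (s * t) ^+ 2 <= a ^+ 2 by rewrite ler_pXn2r// nnegrE; lra.
have := sdot_ge0 (val x); have := sdot_ge0 (val y).
nra.
Qed.

Lemma arcosh_arg_gt0 (t : R) : 1 <= t -> 0 < t + Num.sqrt (t ^+ 2 - 1).
Proof. by move=> t1; have := sqrtr_ge0 (t ^+ 2 - 1); lra. Qed.

Lemma ler_arcosh (s t : R) : 1 <= s -> s <= t -> arcosh s <= arcosh t.
Proof.
move=> s1 st; rewrite ler_ln ?posrE ?arcosh_arg_gt0//; last exact: le_trans st.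
by rewrite lerD// ler_wsqrtr//; nra.
Qed.

Lemma arcoshD (s t : R) : 1 <= s -> 1 <= t ->
  arcosh s + arcosh t =
  arcosh (s * t + Num.sqrt (s ^+ 2 - 1) * Num.sqrt (t ^+ 2 - 1)).
Proof.
move=> s1 t1; rewrite -lnM ?posrE ?arcosh_arg_gt0//; congr ln.
have s2 : 0 <= s ^+ 2 - 1 by nra.
have t2 : 0 <= t ^+ 2 - 1 by nra.
have := sqr_sqrtr s2; have := sqr_sqrtr t2.
have := sqrtr_ge0 (s ^+ 2 - 1); have := sqrtr_ge0 (t ^+ 2 - 1).
set a := Num.sqrt _; set b := Num.sqrt _ => a0 b0 aE bE.
have -> : (s * t + b * a) ^+ 2 - 1 = (s * a + t * b) ^+ 2.
  have -> : (s * t + b * a) ^+ 2 - 1 =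
    s ^+ 2 * t ^+ 2 + b ^+ 2 * a ^+ 2 + 2 * s * t * a * b - 1 by ring.
  have -> : (s * a + t * b) ^+ 2 =
    s ^+ 2 * a ^+ 2 + t ^+ 2 * b ^+ 2 + 2 * s * t * a * b by ring.
  by rewrite aE bE; ring.
by rewrite sqrtr_sqr ger0_norm; [ring|nra].
Qed.

Lemma hdistxx x : hdist x x = 0.
Proof. by rewrite /hdist /arcosh (hspaceP x).1 opprK expr1n subrr sqrtr0 addr0 ln1. Qed.

Lemma hdist_sym x y : hdist x y = hdist y x.
Proof. by rewrite /hdist lorentzC. Qed.

Lemma hdist_positivity x y : hdist x y = 0 -> x = y.
Proof.
have H := lorentz_hspace_le x y.
have p1 : 1 <= - lorentz (val x) (val y) by lra.
rewrite /hdist /arcosh => /eqP; rewrite ln_eq0 ?arcosh_arg_gt0// => /eqP E.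
have := sqrtr_ge0 ((- lorentz (val x) (val y)) ^+ 2 - 1) => r0.
have xy : lorentz (val x) (val y) = -1 by lra.
have := lorentz_orth_eq0 (rej_orth x y).
rewrite rejE (hspaceP x).1 /rej xy => /(_ _)/eqP.
rewrite scaleN1r subr_eq0 => h; apply/val_inj/eqP/h; ring.
Qed.

Lemma hdist_triangle y x z : hdist x z <= hdist x y + hdist y z.
Proof.
have le1 (u v : hspace) : 1 <= - lorentz (val u) (val v).
  by have := lorentz_hspace_le u v; lra.
have Hxy := le1 x y; have Hyz := le1 y z.
rewrite /hdist arcoshD//; apply: ler_arcosh; first exact: le1.
have := lorentz_orth_CS (rej_orth x y) (rej_orth z y).
rewrite !rejE (hspaceP x).1 (hspaceP z).1 (lorentzC (val z) (val y)).
move: {le1} Hxy Hyz.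
set r := lorentz (val x) (val z).
set p := lorentz (val x) (val y); set q := lorentz (val y) (val z).
move=> p1 q1 CS.
rewrite -sqrtrM; last by nra.
suff : - (r + p * q) <= Num.sqrt (((- p) ^+ 2 - 1) * ((- q) ^+ 2 - 1)) by lra.
apply: le_trans (ler_norm _) _; rewrite normrN -sqrtr_sqr ler_wsqrtr//.
by apply: le_trans CS _; rewrite le_eqVlt; apply/orP; left; apply/eqP; ring.
Qed.

HB.instance Definition _ :=
  @isMetric.Build R hspace hdist hdistxx hdist_positivity hdist_sym
    hdist_triangle.

Lemma mdist_hspaceE x y : mdist x y = hdist x y.
Proof. by []. Qed.

End HyperbolicSpace.
Arguments hspace : clear implicits.

Section ConvexBodies.
Context {R : realType} {d : nat}.
Implicit Types (x y z a b p : hspace R d) (A B C D W : set (hspace R d)).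
Implicit Types delta w : R.

Definition dist A B : R := inf [set mdist a b | a in A & b in B].

Definition diam A : \bar R := ereal_sup [set (mdist x y)%:E | x in A & y in A].

(* In the hyperboloid model, the geodesic segment ab is the part of the
   hyperboloid in the convex cone spanned by a and b. *)
Definition geodesic_segment a b : set (hspace R d) :=
  [set z | exists s t : R,
     [/\ 0 <= s, 0 <= t & val z = s *: val a + t *: val b]].

Definition convex C : Prop :=
  forall a b, C a -> C b -> geodesic_segment a b `<=` C.

Definition bounded C : Prop :=
  exists r : R, forall a b, C a -> C b -> mdist a b <= r.

Definition convex_body C : Prop :=
  [/\ closed C, bounded C, convex C & C° !=set0].

Definition bd C : set (hspace R d) := closure C `\` C°.

(* The non-empty sections of the hyperboloid by linear hyperplanes are those
   whose Lorentz normal vector is spacelike. *)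
Record hyperplane : Type := Hyperplane {
  normal : 'rV[R]_d.+1;
  normal_spacelike : 0 < lorentz normal normal }.

Implicit Types H J : hyperplane.

Definition hpoints H : set (hspace R d) :=
  [set x | lorentz (val x) (normal H) = 0].

(* A point at infinity is a line of null vectors; it is represented here by
   every non-zero vector of that line. *)
Definition hpoints_at_infinity H : set 'rV[R]_d.+1 :=
  [set n | [/\ n != 0, lorentz n n = 0 & lorentz n (normal H) = 0]].

Definition ultraparallel H J : Prop :=
  hpoints H `&` hpoints J = set0 /\
  hpoints_at_infinity H `&` hpoints_at_infinity J = set0.

Definition supports H C : Prop :=
  hpoints H `&` C !=set0 /\ hpoints H `&` C° = set0.

Definition farthest_supporting H C J : Prop :=
  [/\ ultraparallel H J, supports J C &
     forall J', ultraparallel H J' -> supports J' C ->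
       dist (hpoints H) (hpoints J') <= dist (hpoints H) (hpoints J)].

(* width_H(C) = w, as a relation: the value does not depend on the choice of
   the farthest hyperplane J. *)
Definition is_width H C w : Prop :=
  exists2 J, farthest_supporting H C J & dist (hpoints H) (hpoints J) = w.

Definition constant_width W delta : Prop :=
  convex_body W /\ forall H, supports H W -> is_width H W delta.

Definition constant_diameter D delta : Prop :=
  [/\ convex_body D, diam D = delta%:E &
     forall p, bd D p -> exists2 p', bd D p' & mdist p p' = delta].

Definition complete_set C : Prop :=
  forall x, ~ C x -> (diam C < diam (C `|` [set x]))%E.

Definition complete_body C : Prop := convex_body C /\ complete_set C.

End ConvexBodies.

(* Main.v *)
Require Import Defs.
From mathcomp Require Import all_boot all_order all_algebra.
From mathcomp Require Import ring lra.
From mathcomp Require Import all_classical all_reals all_analysis.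

(** Everything rests on one picture: at a point p of a convex body, the
    hyperplane through p orthogonal to the segment from p to x bounds a
    half-space containing the body in two situations: x is outside and p is
    the point of the body nearest to x ([nearest_halfspace]), or p is the point
    of the body farthest from x ([farthest_halfspace]). In both cases the
    hyperplane supports the body, because an interior point on it could be
    pushed out of the half-space ([interior_halfspace]). Closed bounded sets
    being compact ([closed_bounded_compact]), nearest and farthest points exist,
    and so do two points realizing the diameter.

    Constant diameter implies completeness. For x outside D, let p be the
    nearest point of D and q a point of D at distance delta from p. The
    half-space at p does not contain x, so the angle at p between x and q is not
    acute, and the hyperbolic Pythagorean inequality
    cosh |xq| >= cosh |xp| cosh |pq| gives |xq| > delta.

    Completeness implies constant diameter. Let q be the point farthest from a
    boundary point p. If |pq| < delta, a point outside the body close enough to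
    p could be added without increasing the diameter. So |pq| = delta, and q,
    being a farthest point, is a boundary point ([farthest_bd]).

    Constant width implies constant diameter. The hyperplane J that realizes
    the width determined by H touches W at some q, and then
    |aq| >= dist(H, J) = delta for every a on H ([constant_width_far]). This
    bounds the diameter below by delta. If a and b realize the diameter,
    the hyperplanes orthogonal to ab at a and b support W, are ultraparallel and
    lie at distance |ab| from each other, so |ab| <= delta by the maximality
    in the definition of the width. A boundary point p is approximated by
    points outside W, whose nearest points in W also tend to p and carry
    supporting hyperplanes; so the largest distance from p to a point of W,
    which is attained, is at least delta - e for every e > 0. *)

Set Implicit Arguments.
Unset Strict Implicit.
Unset Printing Implicit Defensive.

Import Order.TTheory GRing.Theory Num.Theory.
Import numFieldNormedType.Exports.

Local Open Scope classical_set_scope.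
Local Open Scope ring_scope.

(** * Hyperbolic cosine and the Lorentz form *)

Section Cosh.
Context {R : realType}.
Implicit Types e f t : R.

Definition cosh e : R := (expR e + expR (- e)) / 2.

Lemma cosh_ge1 e : 1 <= cosh e.
Proof.
rewrite /cosh expRN.
have E0 := expR_gt0 e.
have V0 : 0 < (expR e)^-1 by rewrite invr_gt0.
have := mulfV (lt0r_neq0 E0); move: (expR e) (_^-1) E0 V0 => x y x0 y0 xy.
have := mulr_ge0 (ltW y0) (sqr_ge0 (x - 1)).
have -> : y * (x - 1) ^+ 2 = x * (x * y) - 2 * (x * y) + y by ring.
by rewrite xy; lra.
Qed.

Lemma cosh_arcosh t : 1 <= t -> cosh (arcosh t) = t.
Proof.
move=> t1; have t2 : 0 <= t ^+ 2 - 1 by nra.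
have E0 := arcosh_arg_gt0 t1.
rewrite /cosh expRN /arcosh lnK ?posrE//.
have := sqr_sqrtr t2; move: E0.
move: (Num.sqrt _) => s E0 s2.
have -> : (t + s)^-1 = t - s.
  apply: (mulfI (lt0r_neq0 E0)); rewrite mulfV ?lt0r_neq0//.
  have -> : (t + s) * (t - s) = t ^+ 2 - s ^+ 2 by ring.
  by rewrite s2; ring.
by field.
Qed.

Lemma arcosh_cosh e : 0 <= e -> arcosh (cosh e) = e.
Proof.
move=> e0; rewrite /arcosh /cosh expRN.
have x0 := expR_gt0 e.
have x1 : 1 <= expR e by apply: le_trans (expR_ge1Dx e); rewrite lerDl.
have -> : ((expR e + (expR e)^-1) / 2) ^+ 2 - 1 =
          ((expR e - (expR e)^-1) / 2) ^+ 2.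
  by field; rewrite lt0r_neq0.
rewrite sqrtr_sqr ger0_norm; last first.
  by rewrite divr_ge0// subr_ge0 (le_trans _ x1)// invf_le1.
by rewrite -[RHS](expRK e); congr ln; field; rewrite lt0r_neq0.
Qed.

Lemma ler_cosh e f : 0 <= e -> 0 <= f -> (cosh e <= cosh f) = (e <= f).
Proof.
move=> e0 f0; apply/idP/idP => [/(ler_arcosh (cosh_ge1 e))|ef].
  by rewrite !arcosh_cosh.
rewrite leNgt; apply/negP => lt_fe.
have := ler_arcosh (cosh_ge1 f) (ltW lt_fe); rewrite !arcosh_cosh// => fe.
by move: lt_fe; rewrite (le_anti (introT andP (conj ef fe))) ltxx.
Qed.

Lemma ltr_cosh e f : 0 <= e -> 0 <= f -> (cosh e < cosh f) = (e < f).
Proof. by move=> e0 f0; rewrite !ltNge ler_cosh. Qed.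

End Cosh.

Section LorentzDistance.
Context {R : realType} {d : nat}.
Implicit Types (x y z : hspace R d) (v n : 'rV[R]_d.+1).

Lemma cosh_mdist x y : cosh (mdist x y) = - lorentz (val x) (val y).
Proof.
by rewrite mdist_hspaceE cosh_arcosh//; have := lorentz_hspace_le x y; lra.
Qed.

(** Comparing distances amounts to comparing Lorentz products, in the reverse
    order: this is how all metric hypotheses become polynomial inequalities. *)
Lemma le_mdist x y x' y' : (mdist x y <= mdist x' y') =
  (lorentz (val x') (val y') <= lorentz (val x) (val y)).
Proof. by rewrite -[RHS]lerN2 -!cosh_mdist ler_cosh// mdist_ge0. Qed.

Lemma lorentzxx x : lorentz (val x) (val x) = -1.
Proof. exact: (hspaceP x).1. Qed.

Lemma lorentz_neq_lt x y : x != y -> lorentz (val x) (val y) < -1.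
Proof.
by rewrite -(lorentzxx x) -mdist_gt0 -(mdistxx x) !ltNge le_mdist.
Qed.

Lemma lorentzNl (u v : 'rV[R]_d.+1) : lorentz (- u) v = - lorentz u v.
Proof. by rewrite -scaleN1r lorentzZl mulN1r. Qed.

Lemma lorentzNr (u v : 'rV[R]_d.+1) : lorentz u (- v) = - lorentz u v.
Proof. by rewrite lorentzC lorentzNl lorentzC. Qed.

Definition lorentzE := (@lorentzDl R d, @lorentzDr R d, lorentzNl, lorentzNr,
  @lorentzZl R d, @lorentzZr R d, lorentzxx).

(** The central projection of a timelike vector on the hyperboloid. The point y
    only selects the upper sheet: two timelike vectors point to the same sheet
    iff their Lorentz product is negative. *)
Lemma normalize v y : lorentz v v < 0 -> lorentz v (val y) < 0 ->
  exists z : hspace R d, val z = (Num.sqrt (- lorentz v v))^-1 *: v.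
Proof.
move=> vv vy; set s := Num.sqrt _.
have s0 : 0 < s by rewrite sqrtr_gt0 oppr_gt0.
have s2 : s ^+ 2 = - lorentz v v by rewrite sqr_sqrtr// oppr_ge0 ltW.
have unit_sV : lorentz (s^-1 *: v) (s^-1 *: v) = -1.
  rewrite !lorentzE -[X in _ * (_ * X)]opprK -s2; field.
  by rewrite lt0r_neq0.
have [t0|t0|t0] := ltgtP 0 (time v).
- have ok : on_hyperboloid (s^-1 *: v).
    by rewrite /on_hyperboloid unit_sV eqxx /time mxE mulr_gt0// invr_gt0.
  by exists (exist on_hyperboloid _ ok).
- have ok : on_hyperboloid (- (s^-1 *: v)).
    rewrite /on_hyperboloid !lorentzNl !lorentzNr opprK unit_sV eqxx /=.
    by rewrite /time !mxE oppr_gt0 pmulr_rlt0// invr_gt0.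
  have := lorentz_hspace_le (exist on_hyperboloid _ ok : hspace R d) y.
  rewrite /= !lorentzE => h.
  have : s^-1 * lorentz v (val y) < 0 by rewrite pmulr_rlt0// invr_gt0.
  by lra.
- by move: vv; rewrite /lorentz -t0 mulr0 oppr0 add0r ltNge sdot_ge0.
Qed.

End LorentzDistance.

(** * Closed bounded sets are compact *)

Section Compactness.
Context {R : realType} {d : nat}.
Implicit Types (x y : hspace R d) (v w : 'rV[R]_d.+1).

Let height w : R := Num.sqrt (1 + sdot w w).

Let graph_vec w : 'rV[R]_d.+1 :=
  \row_j (if j == ord0 then height w else w 0 j).

Let sqr_height w : height w ^+ 2 = 1 + sdot w w.
Proof. by rewrite sqr_sqrtr// addr_ge0// sdot_ge0. Qed.

Let height_gt0 w : 0 < height w.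
Proof. by rewrite sqrtr_gt0 ltr_pwDl// sdot_ge0. Qed.

Let lorentz_graph_vec v w :
  lorentz (graph_vec v) (graph_vec w) = sdot v w - height v * height w.
Proof.
rewrite /lorentz /time !mxE eqxx addrC; congr (_ - _).
by apply: eq_bigr => i _; rewrite !mxE.
Qed.

Let graph_vec_hspace w : on_hyperboloid (graph_vec w).
Proof.
rewrite /on_hyperboloid lorentz_graph_vec -expr2 sqr_height.
rewrite opprD addrCA subrr addr0 eqxx /time mxE eqxx /=.
exact: height_gt0.
Qed.

(** The hyperboloid is the graph of a function of the spatial coordinates.
    This parametrization has the whole row space as its domain by ignoring the
    time coordinate of its argument, so that on points it is the identity. *)
Definition hyperboloid_graph w : hspace R d :=
  exist on_hyperboloid _ (graph_vec_hspace w).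

Lemma hyperboloid_graph_val x : hyperboloid_graph (val x) = x.
Proof.
have [xx x0] := hspaceP x.
apply/val_inj/rowP => j; rewrite /= mxE; case: eqP => // ->.
have xx' : 1 + sdot (val x) (val x) = time (val x) ^+ 2.
  by move: xx; rewrite /lorentz => xx; lra.
by rewrite /height xx' sqrtr_sqr gtr0_norm.
Qed.

Let cvg_sdot (T : Type) (F : set_system T) (FF : Filter F)
    (f g : T -> 'rV[R]_d.+1) v w :
  f t @[t --> F] --> v -> g t @[t --> F] --> w ->
  sdot (f t) (g t) @[t --> F] --> sdot v w.
Proof.
move=> fv gw; apply: cvg_big => [|i _]; first exact: add_continuous.
apply: cvgM.
  exact: (cvg_comp _ _ fv (@coord_continuous _ _ _ _ _ _)).
exact: (cvg_comp _ _ gw (@coord_continuous _ _ _ _ _ _)).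
Qed.

Let cvg_lorentz_graph (T : Type) (F : set_system T) (FF : Filter F)
    (f : T -> 'rV[R]_d.+1) w : f t @[t --> F] --> w ->
  - (sdot w (f t) - height w * height (f t)) @[t --> F] -->
  - (sdot w w - height w * height w).
Proof.
move=> fw; apply: cvgN; apply: cvgB.
  by apply: cvg_sdot => //; exact: cvg_cst.
apply: cvgM; first exact: cvg_cst.
apply: (@cvg_comp _ _ _ (fun t => 1 + sdot (f t) (f t))); last first.
  exact: sqrt_continuous.
by apply: cvgD; [exact: cvg_cst | exact: cvg_sdot].
Qed.

(** The Lorentz product of the images of w and v is a continuous function of v
    with value -1 at v = w, and cosh of the distance is its opposite. *)
Lemma hyperboloid_graph_continuous : continuous hyperboloid_graph.
Proof.
move=> w; have FF := nbhs_filter w.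
apply/(@metricType_numDomainType.cvgrPdist_lt _ _ _ _ FF) => e e0.
have lorentz_cvg := cvg_lorentz_graph FF (@cvg_id _ (nbhs w)).
have one_lt : - (sdot w w - height w * height w) < cosh e.
  rewrite -lorentz_graph_vec -(cosh_mdist (hyperboloid_graph w)
    (hyperboloid_graph w)) mdistxx.
  by rewrite ltr_cosh// ltW.
have lt_e := cvgr_lt _ lorentz_cvg _ one_lt.
refine (@filterS _ _ FF _ _ _ (lt_e FF)) => v /=; rewrite -lorentz_graph_vec.
rewrite -(cosh_mdist (hyperboloid_graph w) (hyperboloid_graph v)).
by rewrite ltr_cosh ?mdist_ge0// ltW.
Qed.

Lemma normr_coord_le_time x j : `|val x 0 j| <= time (val x).
Proof.
have [xx x0] := hspaceP x.
have [i ->|->] := unliftP ord0 j; last by rewrite ger0_norm// ltW.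
rewrite -ler_sqr ?nnegrE ?normr_ge0 ?(ltW x0)// real_normK ?num_real//.
apply: (@le_trans _ _ (sdot (val x) (val x))).
  rewrite /sdot (bigD1 i)//= -expr2 lerDl; apply: sumr_ge0 => k _.
  by rewrite -expr2 sqr_ge0.
by move: xx; rewrite /lorentz -expr2 => xx; lra.
Qed.

(** The time coordinate of x is the cosh of its distance to the vertex of the
    hyperboloid and bounds the other coordinates, so a bounded set lies in the
    continuous image of a compact box. *)
Lemma closed_bounded_compact (D : set (hspace R d)) :
  closed D -> bounded D -> compact D.
Proof.
move=> clD [r Dr].
have [->|/set0P[c Dc]] := eqVneq D set0; first exact: compact0.
pose base := hyperboloid_graph 0.
pose M := cosh (r + mdist c base).
have time_le x : D x -> time (val x) <= M.
  move=> Dx.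
  have -> : time (val x) = - lorentz (val x) (val base).
    rewrite /lorentz {3}/time mxE eqxx /height.
    have -> : sdot (0 : 'rV[R]_d.+1) 0 = 0.
      by apply: big1 => i _; rewrite mxE mulr0.
    rewrite addr0 sqrtr1 mulr1 opprD opprK.
    rewrite [sdot _ _]big1 ?subr0// => i _.
    by rewrite !mxE /= mulr0.
  have rd : mdist x base <= r + mdist c base.
    by apply: le_trans (metric_triangle x c base) _; rewrite lerD2r Dr.
  rewrite -cosh_mdist ler_cosh ?mdist_ge0//.
  exact: le_trans (mdist_ge0 _ _) rd.
pose K := [set w : 'rV[R]_d.+1 | forall j, [set` `[- M, M]] (w ord0 j)].
have cK : compact K.
  apply: (@rV_compact R d.+1 (fun=> [set` `[- M, M]])) => _.
  exact: segment_compact.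
apply: (subclosed_compact clD (continuous_compact
  (continuous_subspaceT hyperboloid_graph_continuous) cK)).
move=> x Dx; exists (val x); last exact: hyperboloid_graph_val.
move=> j; rewrite /= in_itv /= -ler_norml.
exact: le_trans (normr_coord_le_time x j) (time_le x Dx).
Qed.

Lemma mdist_continuousr x : continuous (fun y => mdist x y).
Proof.
move=> y; apply/(@cvgrPdist_le _ _ _ _ (nbhs_filter y)) => e e0.
apply/nbhs_ballP; exists e => // z; rewrite ballEmdist /= => yz.
have := metric_triangle x y z; have := metric_triangle x z y.
by rewrite (metric_sym z y) ler_norml; lra.
Qed.

Lemma mdist_continuous2 : continuous (fun a : hspace R d * hspace R d =>
  mdist a.1 a.2).
Proof.
move=> [x y]; apply/(@cvgrPdist_le _ _ _ _ (nbhs_filter _)) => e e0.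
apply/nbhs_ballP; exists (e / 2); first by rewrite /= divr_gt0.
move=> [x' y'] [/=]; rewrite !ballEmdist /= => xx yy.
have := metric_triangle x x' y; have := metric_triangle x' y' y.
have := metric_triangle x' x y'; have := metric_triangle x y y'.
by rewrite (metric_sym x' x) (metric_sym y' y) ler_norml; lra.
Qed.

End Compactness.

(** * Half-spaces containing a convex set *)

Section HalfSpaces.
Context {R : realType} {d : nat}.
Implicit Types (x y z p a b : hspace R d) (n v : 'rV[R]_d.+1).
Implicit Types D : set (hspace R d).

(** The component of x orthogonal to p: the initial velocity of the geodesic
    from p to x, of Lorentz norm sinh |px|. *)
Definition tangent p x : 'rV[R]_d.+1 :=
  val x + lorentz (val x) (val p) *: val p.

Lemma lorentz_tangent v p x : lorentz v (tangent p x) =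
  lorentz v (val x) + lorentz (val x) (val p) * lorentz v (val p).
Proof. by rewrite !lorentzE. Qed.

Lemma tangent_orth p x : lorentz (val p) (tangent p x) = 0.
Proof. by rewrite lorentz_tangent lorentzxx lorentzC; ring. Qed.

Lemma tangent_spacelike p x : p != x ->
  0 < lorentz (tangent p x) (tangent p x).
Proof.
move=> /lorentz_neq_lt; rewrite (lorentzC (val p)) => lt1.
by rewrite !lorentzE (lorentzC (val p)); nra.
Qed.

Definition tangent_hyperplane p x (px : p != x) : hyperplane :=
  Hyperplane (tangent_spacelike px).

(** If y were strictly on the side of x, moving from p towards y would
    decrease the distance to x to first order. *)
Lemma nearest_halfspace D x p y : convex D -> D p ->
  (forall z, D z -> mdist x p <= mdist x z) ->
  D y -> lorentz (val y) (tangent p x) <= 0.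
Proof.
move=> cD Dp p_near Dy; rewrite leNgt; apply/negP => S_gt0.
move: (S_gt0); rewrite lorentz_tangent.
have := lorentz_hspace_le x p; have := lorentz_hspace_le y p.
have := lorentz_hspace_le y x.
move: (lorentz_tangent (val y) p x); rewrite (lorentzC (val y) (val x)).
set S := lorentz _ _; set r := lorentz (val x) (val y).
set q := lorentz (val x) (val p); set l := lorentz (val y) (val p).
move=> SE r1 l1 q1 S0.
(* The point of the segment from p to y in the direction p + s y is nearer to
   x than p iff s (r^2 - q^2) < - 2 q S, and s (r^2 + 1) = - q S. *)
pose s := - q * S / (r ^+ 2 + 1).
have s_gt0 : 0 < s by rewrite divr_gt0 ?mulr_gt0//; nra.
have sE : s * (r ^+ 2 + 1) = - q * S by rewrite /s; field; nra.
pose v := val p + s *: val y.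
have vv : lorentz v v = - (1 + s ^+ 2 - 2 * s * l).
  by rewrite !lorentzE (lorentzC (val p)) -/l; ring.
have vx : lorentz (val x) v = q + s * r by rewrite !lorentzE.
have vv0 : lorentz v v < 0 by rewrite vv; nra.
have vp0 : lorentz v (val p) < 0 by rewrite !lorentzE -/l; nra.
have [z zE] := normalize vv0 vp0.
have c_gt0 : 0 < Num.sqrt (- lorentz v v) by rewrite sqrtr_gt0; lra.
have Dz : D z.
  apply: cD Dp Dy _ _; exists (Num.sqrt (- lorentz v v))^-1.
  exists ((Num.sqrt (- lorentz v v))^-1 * s); split.
  - by rewrite invr_ge0 ltW.
  - by apply: mulr_ge0; rewrite ?invr_ge0 ltW.
  - by rewrite zE scalerDr scalerA.
have := p_near z Dz; rewrite le_mdist zE lorentzZr vx -/q.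
have c2 : Num.sqrt (- lorentz v v) ^+ 2 = 1 + s ^+ 2 - 2 * s * l.
  by rewrite sqr_sqrtr; lra.
move: (Num.sqrt _) c_gt0 c2 => c c0 c2.
rewrite mulrC ler_pdivrMr// => le1.
(* The squared numbers are positive: they are cosh |xp| c and - <x, v>. *)
have le2 : (- q * c) ^+ 2 <= (- (q + s * r)) ^+ 2.
  by rewrite ler_sqr ?nnegrE; nra.
have : s * (- 2 * q * S - s * (r ^+ 2 - q ^+ 2)) <= 0.
  have -> : s * (- 2 * q * S - s * (r ^+ 2 - q ^+ 2)) =
            (- q * c) ^+ 2 - (- (q + s * r)) ^+ 2.
    by rewrite exprMn c2 SE; ring.
  by rewrite subr_le0.
by rewrite pmulr_rle0//; nra.
Qed.

(** The ball around x through p lies on one side of its tangent hyperplane at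
    p, and so does any subset of that ball. *)
Lemma farthest_halfspace D p x y :
  (forall z, D z -> mdist x z <= mdist x p) ->
  D y -> 0 <= lorentz (val y) (tangent p x).
Proof.
move=> far Dy; have := far y Dy.
rewrite lorentz_tangent le_mdist (lorentzC _ (val y)).
have := lorentz_hspace_le x p; have := lorentz_hspace_le y p.
nra.
Qed.

(** z is the point at distance e / 2 from y on the geodesic with initial
    direction n, that is, cosh (e/2) y + sinh (e/2) n / |n|. *)
Lemma geodesic_push y n e : lorentz (val y) n = 0 -> 0 < lorentz n n ->
  0 < e -> exists z s t,
    [/\ 0 < t, val z = s *: val y + t *: n & mdist y z < e].
Proof.
move=> yn nn e0; pose h := cosh (e / 2).
have h1 : 1 < h.
  have -> : 1 = cosh 0 :> R by rewrite /cosh oppr0 expR0; lra.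
  by rewrite ltr_cosh//; lra.
pose q := (h ^+ 2 - 1) / lorentz n n.
have q0 : 0 < q by rewrite divr_gt0//; nra.
have tE : Num.sqrt q ^+ 2 * lorentz n n = h ^+ 2 - 1.
  by rewrite sqr_sqrtr ?ltW// /q; field; rewrite lt0r_neq0.
have t0 : 0 < Num.sqrt q by rewrite sqrtr_gt0.
move: (Num.sqrt q) tE t0 => t tE t0.
pose v := h *: val y + t *: n.
have vv : lorentz v v = -1.
  rewrite !lorentzE (lorentzC n) yn.
  have -> : t * (t * lorentz n n) = h ^+ 2 - 1 by rewrite -tE; ring.
  ring.
have vy : lorentz v (val y) = - h by rewrite !lorentzE (lorentzC n) yn; ring.
have [||z] := @normalize _ _ v y; rewrite ?vv ?vy; [lra|lra|].
rewrite opprK sqrtr1 invr1 scale1r => zE.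
exists z, h, t; split=> //; rewrite -ltr_cosh ?mdist_ge0//; last by lra.
rewrite cosh_mdist zE lorentzC vy opprK -[X in _ < X]/(cosh e) /h.
by rewrite ltr_cosh; lra.
Qed.

(** An interior point on the bounding hyperplane could be moved along - n while
    staying in D, and would leave the half-space. *)
Lemma interior_halfspace D z n : 0 < lorentz n n ->
  (forall y, D y -> 0 <= lorentz (val y) n) -> D° z -> 0 < lorentz (val z) n.
Proof.
move=> nn half /nbhs_ballP[e /= e0 De].
have Dz : D z by apply: De; rewrite ballEmdist /= mdistxx.
rewrite lt_neqAle half// andbT; apply/eqP => zn.
have nzn : lorentz (val z) (- n) = 0 by rewrite lorentzNr -zn oppr0.
have nn' : 0 < lorentz (- n) (- n) by rewrite lorentzNl lorentzNr opprK.
have [w [s [t [t0 wE zw]]]] := geodesic_push nzn nn' e0.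
have := half w; rewrite wE !lorentzE -zn.
rewrite mulr0 add0r mulrN oppr_ge0 => /(_ _) h.
have : t * lorentz n n <= 0 by apply: h; apply: De; rewrite ballEmdist.
by rewrite leNgt mulr_gt0.
Qed.

(** The n chosen is the velocity of x under the boost in the plane of the time
    axis and the first spatial axis; this is where the dimension is positive. *)
Lemma spacelike_orth (d_gt0 : (0 < d)%N) x :
  exists2 n, lorentz (val x) n = 0 & 0 < lorentz n n.
Proof.
have [xx x0] := hspaceP x.
pose i := Ordinal d_gt0; pose j := lift ord0 i.
pose n : 'rV[R]_d.+1 := \row_k
  (if k == ord0 then val x 0 j else if k == j then time (val x) else 0).
have n0 : time n = val x 0 j by rewrite /time mxE eqxx.
have nj v : sdot v n = v 0 j * time (val x).
  rewrite /sdot (bigD1 i)//= big1 => [|k ki].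
    by rewrite addr0 mxE eqxx.
  by rewrite mxE /= (inj_eq (@lift_inj _ _)) (negPf ki) mulr0.
have xn : lorentz (val x) n = 0 by rewrite /lorentz nj n0; ring.
exists n => //; rewrite lt_neqAle.
rewrite (@lorentz_orth_ge0 _ _ x) 1?lorentzC// andbT.
apply/eqP => /esym nn0.
have /rowP/(_ j) := lorentz_orth_eq0 (etrans (lorentzC _ _) xn) nn0.
by rewrite !mxE eqxx /= => t0; move: x0; rewrite t0 ltxx.
Qed.

Lemma closed_bdP D p : closed D -> bd D p <-> D p /\ ~ D° p.
Proof. by move=> /closure_id cD; rewrite /bd -cD. Qed.

End HalfSpaces.

(** * Perpendiculars to a segment at its endpoints *)

Section Perpendiculars.
Context {R : realType} {d : nat}.
Implicit Types (x y a b : hspace R d) (A B D : set (hspace R d)).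

Lemma dist_le A B a b : A a -> B b -> dist A B <= mdist a b.
Proof.
move=> Aa Bb; apply: ge_inf; last by exists a => //; exists b.
by exists 0 => _ [x _ [y _ <-]]; exact: mdist_ge0.
Qed.

Lemma tangent_hyperplane_base a b (ab : a != b) :
  hpoints (tangent_hyperplane ab) a.
Proof. exact: tangent_orth. Qed.

(** Decompose x = - al a + xo and y = - be b + yo with xo and yo orthogonal to
    the plane of a and b; here al and be are at most -1 since they are products
    of points. Then - <x, y> = - al be <a, b> - <xo, yo>, and the
    Cauchy-Schwarz inequality bounds <xo, yo> by al be - 1. *)
Lemma perpendicular_mdist_ge a b x y (ab : a != b) (ba : b != a) :
  hpoints (tangent_hyperplane ab) x -> hpoints (tangent_hyperplane ba) y ->
  mdist a b <= mdist x y.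
Proof.
rewrite /hpoints /= !lorentz_tangent (lorentzC (val b)) => xH yJ.
have ab1 := lorentz_neq_lt ab.
rewrite le_mdist.
have xa := lorentz_hspace_le x a; have yb := lorentz_hspace_le y b.
move: xH yJ ab1 xa yb.
set c := lorentz (val a) (val b).
set al := lorentz (val x) (val a); set be := lorentz (val y) (val b).
move=> xH yJ ab1 xa yb.
pose xo := val x + al *: val a; pose yo := val y + be *: val b.
have xoa : lorentz xo (val a) = 0 by rewrite !lorentzE -/al; ring.
have yoa : lorentz yo (val a) = 0.
  by rewrite !lorentzE (lorentzC (val b)) -/c; lra.
have := lorentz_orth_CS xoa yoa.
have -> : lorentz xo xo = al ^+ 2 - 1.
  by rewrite !lorentzE (lorentzC (val a)) -/al; ring.
have -> : lorentz yo yo = be ^+ 2 - 1.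
  by rewrite !lorentzE (lorentzC (val b) (val y)) -/be; ring.
have -> : lorentz xo yo = lorentz (val x) (val y) - al * be * c.
  rewrite !lorentzE (lorentzC (val a) (val y)) -/c.
  have -> : lorentz (val x) (val b) = - (c * al) by lra.
  have -> : lorentz (val y) (val a) = - (c * be) by lra.
  ring.
set r := lorentz (val x) (val y) => CS.
have ab_ge1 : 1 <= al * be by nra.
(* (al^2 - 1)(be^2 - 1) = (al be - 1)^2 - (al - be)^2. *)
have CS2 : (r - al * be * c) ^+ 2 <= (al * be - 1) ^+ 2.
  by apply: le_trans CS _; have := sqr_ge0 (al - be); lra.
have : r - al * be * c <= al * be - 1.
  apply: le_trans (ler_norm _) _.
  rewrite -[leRHS]ger0_norm ?subr_ge0//.
  by rewrite -ler_sqr ?nnegrE// !real_normK ?num_real.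
nra.
Qed.

Lemma perpendicular_dist_ge a b (ab : a != b) (ba : b != a) :
  mdist a b <= dist (hpoints (tangent_hyperplane ab))
                    (hpoints (tangent_hyperplane ba)).
Proof.
apply: lb_le_inf => [|_ [x xH [y yJ <-]]]; last first.
  exact: perpendicular_mdist_ge xH yJ.
exists (mdist a b); exists a; first exact: tangent_hyperplane_base.
by exists b => //; exact: tangent_hyperplane_base.
Qed.

(** A common point would contradict the bound on the distance between points
    of the two hyperplanes. A vector orthogonal to both normals is orthogonal to
    the plane they span, which is the plane of a and b, hence to the timelike
    vector a. It is then spacelike, so it is not a point at infinity. *)
Lemma perpendicular_ultraparallel a b (ab : a != b) (ba : b != a) :
  ultraparallel (tangent_hyperplane ab) (tangent_hyperplane ba).
Proof.
split; apply/seteqP; split=> // x.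
  move=> [xH xJ]; have := perpendicular_mdist_ge xH xJ.
  by rewrite mdistxx leNgt mdist_gt0 ab.
move=> [[x0 xx xH] [_ _ xJ]]; move: xH xJ.
rewrite /= !lorentz_tangent (lorentzC (val b)).
have := lorentz_neq_lt ab; set c := lorentz (val a) (val b).
move=> c1 xH xJ.
have xa0 : lorentz x (val a) * (1 - c ^+ 2) = 0.
  have -> : lorentz x (val a) * (1 - c ^+ 2) =
      lorentz x (val a) + c * lorentz x (val b) -
      c * (lorentz x (val b) + c * lorentz x (val a)) by ring.
  by rewrite xH xJ; ring.
move: xa0 => /eqP; rewrite mulf_eq0 => /orP[/eqP xa0|/eqP]; last by nra.
by move/eqP: x0; apply; exact: lorentz_orth_eq0 xa0 xx.
Qed.

End Perpendiculars.

(** * Supporting hyperplanes, diameter and width of bodies *)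

Section Bodies.
Context {R : realType} {d : nat}.
Implicit Types (x y a b p q : hspace R d) (C D W : set (hspace R d)).
Implicit Types (H : @hyperplane R d) (delta : R).

Lemma supports_halfspace H D p : D p -> hpoints H p ->
  (forall y, D y -> 0 <= lorentz (val y) (normal H)) -> supports H D.
Proof.
move=> Dp Hp half; split; first by exists p.
apply/seteqP; split=> // y [yH Dy].
by have := interior_halfspace (normal_spacelike H) half Dy; rewrite yH ltxx.
Qed.

Lemma supports_halfspaceN H D p : D p -> hpoints H p ->
  (forall y, D y -> lorentz (val y) (normal H) <= 0) -> supports H D.
Proof.
move=> Dp Hp half; split; first by exists p.
apply/seteqP; split=> // y [yH Dy].
have nn : 0 < lorentz (- normal H) (- normal H).
  by rewrite lorentzNl lorentzNr opprK normal_spacelike.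
have halfN z : D z -> 0 <= lorentz (val z) (- normal H).
  by move=> Dz; rewrite lorentzNr oppr_ge0 half.
by have := interior_halfspace nn halfN Dy; rewrite lorentzNr yH oppr0 ltxx.
Qed.

Lemma diam_leP D delta : (diam D <= delta%:E)%E <->
  forall x y, D x -> D y -> mdist x y <= delta.
Proof.
split=> [le x y Dx Dy|le].
  rewrite -lee_fin; apply: le_trans le; apply: ereal_sup_ubound.
  by exists x => //; exists y.
by apply: ge_ereal_sup => _ [x Dx [y Dy <-]]; rewrite lee_fin le.
Qed.

Lemma le_diam D x y : D x -> D y -> ((mdist x y)%:E <= diam D)%E.
Proof. by move=> Dx Dy; apply: ereal_sup_ubound; exists x => //; exists y. Qed.

Lemma body_compact D : convex_body D -> compact D.
Proof. by case=> clD bdD _ _; exact: closed_bounded_compact. Qed.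

Lemma body_neq0 D : convex_body D -> D !=set0.
Proof. by case=> _ _ _ [c /interior_subset Dc]; exists c. Qed.

Lemma exists_nearest D x : convex_body D ->
  exists2 p, D p & forall y, D y -> mdist x p <= mdist x y.
Proof.
move=> bD; have [p pD p_min] := compact_EVT_min (body_neq0 bD) (body_compact bD)
  (continuous_subspaceT (@mdist_continuousr R d x)).
by exists p => [|y Dy]; [exact: set_mem|apply: p_min; exact: mem_set].
Qed.

Lemma exists_farthest D x : convex_body D ->
  exists2 p, D p & forall y, D y -> mdist x y <= mdist x p.
Proof.
move=> bD; have [p pD p_max] := compact_EVT_max (body_neq0 bD) (body_compact bD)
  (continuous_subspaceT (@mdist_continuousr R d x)).
by exists p => [|y Dy]; [exact: set_mem|apply: p_max; exact: mem_set].
Qed.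

Lemma exists_diameter D : convex_body D -> exists a b,
  [/\ D a, D b & forall x y, D x -> D y -> mdist x y <= mdist a b].
Proof.
move=> bD; have [c Dc] := body_neq0 bD.
have DD0 : D `*` D !=set0 by exists (c, c).
have [[a b] /set_mem[Da Db] ab_max] := compact_EVT_max DD0
  (compact_setX (body_compact bD) (body_compact bD))
  (continuous_subspaceT (@mdist_continuous2 R d)).
exists a, b; split=> // x y Dx Dy.
by apply: (ab_max (x, y)); exact: mem_set.
Qed.

(** The diameter of a body is positive, so a pair of points realizing it is a
    pair of distinct points and determines tangent hyperplanes. *)
Lemma body_two_points (d_gt0 : (0 < d)%N) D : convex_body D ->
  exists a b, [/\ D a, D b & a != b].
Proof.
case=> _ _ _ [a Da]; have [n an nn] := spacelike_orth d_gt0 a.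
have /nbhs_ballP[e /= e0 De] := Da.
have [b [s [t [t0 bE ab]]]] := geodesic_push an nn e0.
exists a, b; split.
- exact: interior_subset Da.
- by apply: De; rewrite ballEmdist.
- have bn : lorentz (val b) n = t * lorentz n n.
    by rewrite bE !lorentzE an; ring.
  by apply/eqP => abE; have := mulr_gt0 t0 nn; rewrite -bn -abE an ltxx.
Qed.

(** The hyperplane orthogonal to pq at q supports D, so q is not interior. *)
Lemma farthest_bd D p q : closed D -> D q -> p != q ->
  (forall y, D y -> mdist p y <= mdist p q) -> bd D q.
Proof.
move=> clD Dq pq far; apply/closed_bdP => //; split=> // Dq'.
have qp : q != p by rewrite eq_sym.
have [_] := supports_halfspace (H := tangent_hyperplane qp) Dq
  (tangent_hyperplane_base qp) (fun y => farthest_halfspace far).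
move=> /seteqP[/(_ q) + _]; apply; split=> //.
exact: tangent_hyperplane_base.
Qed.

Lemma nearest_supports D p x (px : p != x) : convex D -> D p ->
  (forall y, D y -> mdist x p <= mdist x y) ->
  supports (tangent_hyperplane px) D.
Proof.
move=> cD Dp near; apply: (supports_halfspaceN Dp (tangent_hyperplane_base px)).
by move=> y; exact: (nearest_halfspace cD Dp near).
Qed.

Lemma bd_exterior D p e : bd D p -> 0 < e -> exists2 x, ~ D x & mdist p x < e.
Proof.
move=> [_ nDp] e0; apply: contrapT => h; apply: nDp.
apply/nbhs_ballP; exists e => // x; rewrite ballEmdist /= => px.
by apply: contrapT => nDx; apply: h; exists x.
Qed.

Lemma constant_diameter_complete D delta :
  constant_diameter D delta -> complete_set D.
Proof.
move=> [bD diamD partner] x nDx; have [clD _ cD _] := bD.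
have [p Dp near] := exists_nearest x bD.
have px : p != x by apply/eqP => pE; apply: nDx; rewrite -pE.
have [Hp Hint] := nearest_supports px cD Dp near.
have /partner[q bdq pq] : bd D p.
  apply/closed_bdP => //; split=> // Dp'.
  move/seteqP: Hint => [/(_ p) + _]; apply; split=> //.
  exact: tangent_hyperplane_base.
have [Dq _] := (closed_bdP q clD).1 bdq.
have dlt : delta < mdist x q.
  have := nearest_halfspace cD Dp near Dq; rewrite lorentz_tangent.
  rewrite -pq ltNge le_mdist !(lorentzC (val q)) => h.
  (* h reads cosh |xq| >= cosh |xp| cosh |pq|, and cosh |xp| > 1. *)
  apply/negP => le; have := lorentz_neq_lt px; rewrite (lorentzC (val p)).
  have := lorentz_hspace_le p q.
  nra.
rewrite diamD; apply: (@lt_le_trans _ _ (mdist x q)%:E).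
  by rewrite lte_fin.
by apply: le_diam; [right|left].
Qed.

Lemma complete_constant_diameter (d_gt0 : (0 < d)%N) D delta :
  convex_body D -> complete_set D -> diam D = delta%:E ->
  constant_diameter D delta.
Proof.
move=> bD complD diamD; split=> // p bdp; have [clD _ _ _] := bD.
have [Dp _] := (closed_bdP p clD).1 bdp.
have le_delta : forall x y, D x -> D y -> mdist x y <= delta.
  by apply/diam_leP; rewrite diamD.
have [q Dq far] := exists_farthest p bD.
have pqE : mdist p q = delta.
  apply/eqP; rewrite eq_le le_delta// leNgt; apply/negP => lt.
  have [x nDx px] : exists2 x, ~ D x & mdist p x < delta - mdist p q.
    by apply: bd_exterior; rewrite ?subr_gt0.
  have := complD x nDx; rewrite ltNge diamD => /negP; apply.
  have x_le y : D y -> mdist x y <= delta.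
    move=> Dy; apply: le_trans (metric_triangle x p y) _.
    by rewrite metric_sym; have := far y Dy; lra.
  apply/diam_leP => y z [Dy|->] [Dz|->].
  - exact: le_delta.
  - by rewrite metric_sym x_le.
  - exact: x_le.
  - by rewrite mdistxx (le_trans (mdist_ge0 p q))// ltW.
exists q => //; apply: farthest_bd far => //.
rewrite -mdist_gt0 pqE.
have [a [b [Da Db ab]]] := body_two_points d_gt0 bD.
by apply: lt_le_trans (le_delta _ _ Da Db); rewrite mdist_gt0.
Qed.

(** q is any contact point of the farthest supporting hyperplane J; the width
    dist(H, J) is an infimum over pairs of points, and (a, q) is such a pair. *)
Lemma constant_width_far W delta H a : constant_width W delta ->
  supports H W -> hpoints H a -> exists2 q, W q & delta <= mdist a q.
Proof.
move=> [_ width] /width[J [_ [[q [Jq Wq]] _] _] <-] Ha.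
by exists q => //; exact: dist_le.
Qed.

Lemma constant_width_diameter (d_gt0 : (0 < d)%N) W delta :
  constant_width W delta -> constant_diameter W delta.
Proof.
move=> wW; have [bW width] := wW; have [clW _ cW _] := bW.
have [a [b [Wa Wb ab_max]]] := exists_diameter bW.
have ab : a != b.
  have [x [y [Wx Wy xy]]] := body_two_points d_gt0 bW.
  by rewrite -mdist_gt0 (lt_le_trans _ (ab_max _ _ Wx Wy))// mdist_gt0.
have ba : b != a by rewrite eq_sym.
have supp_a : supports (tangent_hyperplane ab) W.
  apply: supports_halfspace Wa (tangent_hyperplane_base ab) _ => y.
  apply: farthest_halfspace => z Wz; rewrite (metric_sym b a); exact: ab_max.
have supp_b : supports (tangent_hyperplane ba) W.
  apply: supports_halfspace Wb (tangent_hyperplane_base ba) _ => y.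
  by apply: farthest_halfspace => z Wz; exact: ab_max.
have ab_le : mdist a b <= delta.
  apply: le_trans (perpendicular_dist_ge ab ba) _.
  have [J [_ _ J_far] <-] := width _ supp_a.
  exact: J_far (perpendicular_ultraparallel ab ba) supp_b.
have le_delta x y : W x -> W y -> mdist x y <= delta.
  by move=> Wx Wy; apply: le_trans ab_le; exact: ab_max.
split=> //.
  apply/eqP; rewrite eq_le; apply/andP; split; first exact/diam_leP.
  have [q Wq le] := constant_width_far wW supp_a (tangent_hyperplane_base ab).
  by apply: le_trans (le_diam Wa Wq); rewrite lee_fin.
move=> p bdp; have [Wp _] := (closed_bdP p clW).1 bdp.
have [q Wq far] := exists_farthest p bW.
have pqE : mdist p q = delta.
  apply/eqP; rewrite eq_le le_delta// leNgt; apply/negP => lt.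
  (* |cp| <= |cx| + |xp| <= 2 |xp| because p competes for the nearest point c;
     this is why half of the gap is taken. *)
  have [x nWx px] : exists2 x, ~ W x & mdist p x < (delta - mdist p q) / 2.
    by apply: bd_exterior; rewrite ?divr_gt0 ?subr_gt0.
  have [c Wc near] := exists_nearest x bW.
  have cx : c != x by apply/eqP => cE; apply: nWx; rewrite -cE.
  have [z Wz] := constant_width_far wW (nearest_supports cx cW Wc near)
    (tangent_hyperplane_base cx).
  have := metric_triangle c p z; have := metric_triangle c x p.
  have := near p Wp; have := far z Wz.
  by rewrite (metric_sym c x) (metric_sym x p); lra.
exists q => //; apply: farthest_bd far => //.
by rewrite -mdist_gt0 pqE (lt_le_trans _ ab_le)// mdist_gt0.
Qed.

End Bodies.

Theorem theorem3 (R : realType) (d : nat) (hd : (1 <= d)%N)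
    (C : set (hspace R d)) (delta : R) :
  (constant_width C delta -> constant_diameter C delta) /\
  (constant_diameter C delta <-> (complete_body C /\ diam C = delta%:E)).
Proof.
split; first exact: constant_width_diameter.
split=> [cd|[[bC cC] diamC]]; last exact: complete_constant_diameter.
have [bC diamC _] := cd.
by split=> //; split=> //; exact: constant_diameter_complete cd.
Qed.
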